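(* Let $a,b\in\mathbb{R}$ and let $n\ge 5$ be an integer. Let $B^{(n)}$ be the $n\times n$ real matrix with entries $$B^{(n)}_{ij} = \begin{cases} 1, & \text{if } -2 \le j-i \le 1,\\ a, & \text{if } (i,j)=(1,n-1) \text{ or } (i,j)=(2,n),\\ b, & \text{if } (i,j)=(1,n),\\ 0, & \text{otherwise},\end{cases}$$ and let $B_n=\det B^{(n)}$. Then $$B_n=\begin{cases} (a-1)^2, & n\equiv 0 \pmod 4,\\ a^2+b+1, & n\equiv 1 \pmod 4,\\ a^2+2a-b, & n\equiv 2 \pmod 4,\\ a^2, & n\equiv 3 \pmod 4.\end{cases}$$
   Context: $B^{(n)}$ is the Toeplitz matrix with ones on the first superdiagonal, main diagonal and first two subdiagonals, the value $a$ on the $(n-2)$-th superdiagonal (positions $(1,n-1)$ and $(2,n)$), the value $b$ in the top-right corner $(1,n)$, and zeros elsewhere. *)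

(* Defs.v *)
From HB Require Import structures.
From mathcomp Require Import all_boot all_order all_algebra.
From mathcomp Require Import reals.

Set Implicit Arguments.
Unset Strict Implicit.
Unset Printing Implicit Defensive.

Import Order.TTheory GRing.Theory Num.Theory.

Local Open Scope ring_scope.

(* Ordinals start at 0: the row and column numbers, counted from 1, are
   i.+1 and j.+1. The difference j - i is taken in int, since subtraction
   on nat is truncated; it is the same for both numberings. *)
Definition Bmx (R : realType) (n : nat) (a b : R) : 'M[R]_n :=
  \matrix_(i < n, j < n)
    if (- 2 <= j%:Z - i%:Z) && (j%:Z - i%:Z <= 1) then 1
    else if ((i.+1, j.+1) == (1, n - 1)%N) || ((i.+1, j.+1) == (2, n)%N) then a
    else if (i.+1, j.+1) == (1, n)%N then b
    else 0.

(* Main.v *)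
Require Import Defs.
From HB Require Import structures.
From mathcomp Require Import all_boot all_order all_algebra.
From mathcomp Require Import perm.
From mathcomp Require Import reals.
From mathcomp Require Import zify ring.
Import Order.TTheory GRing.Theory Num.Theory.
Local Open Scope ring_scope.

(** The band of rows 3, ..., n - 1 acts on sequences by
    x_{i-2} + x_{i-1} + x_i + x_{i+1}, which kills the three 4-periodic sequences
    [kerseq j] that start with a standard basis vector of R^3. Replacing the first
    three columns of the identity by these sequences gives a unitriangular [Pmx]
    such that B * Pmx vanishes on rows 3, ..., n - 1 and columns 1, 2, 3. Moving
    the last row of B up to the third place makes B * Pmx block upper triangular;
    the lower right block is unitriangular, and the 3 x 3 upper left block depends
    only on n modulo 4. *)

Lemma sum_deltas {R : pzRingType} {n : nat} (f : nat -> R) (s : seq (nat * R)) :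
  all (fun p => p.1 < n)%N s ->
  \sum_(k < n) (\sum_(p <- s) (k == p.1 :> nat)%:R * p.2) * f k
  = \sum_(p <- s) p.2 * f p.1.
Proof.
move=> /allP sn; under eq_bigr do rewrite mulr_suml.
rewrite exchange_big !big_seq; apply: eq_bigr => p /sn pn /=.
rewrite (bigD1 (Ordinal pn)) //= eqxx mul1r big1 ?addr0 // => k.
by rewrite -val_eqE /= => /negbTE ->; rewrite !mul0r.
Qed.

Definition kerseq {R : pzRingType} (j k : nat) : R :=
  if (k %% 4 == 3)%N then -1 else (k %% 4 == j)%N%:R.

Lemma kerseq_small {R : pzRingType} (j k : nat) :
  (j < 3)%N -> (k < 3)%N -> kerseq j k = (k == j)%:R :> R.
Proof. by case: k => [|[|[|]]]. Qed.

Lemma kerseq_modD {R : pzRingType} (j c k : nat) :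
  kerseq j (c + k) = kerseq j (c + k %% 4) :> R.
Proof. by rewrite /kerseq modnDmr. Qed.

(** Four consecutive indices meet each residue modulo 4 once, so the 1 at residue [j] cancels the -1
    at residue 3. *)
Lemma kerseq_sum4 {R : comPzRingType} (j k : nat) : (j < 3)%N ->
  kerseq j k + kerseq j k.+1 + kerseq j k.+2 + kerseq j k.+3 = 0 :> R.
Proof.
rewrite -(addn3 k) -(addn2 k) -(addn1 k) /kerseq.
rewrite -(modnDml k 1) -(modnDml k 2) -(modnDml k 3).
have : (k %% 4 < 4)%N by rewrite ltn_mod.
by case: (k %% 4)%N => [|[|[|[|]]]] //; case: j => [|[|[|]]] //= _ _; ring.
Qed.

(** The list [s] holds the column-value pairs of the entries that may be nonzero; a row given as a
    sum of deltas needs no manual splitting of the big sum. *)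
Lemma sparse_row {R : pzRingType} {m n : nat} {A : 'M[R]_(m, n)}
    (s : seq (nat * R)) (f : nat -> R) (i : 'I_m) :
  all (fun p => p.1 < n)%N s ->
  (forall k : 'I_n, A i k = \sum_(p <- s) (k == p.1 :> nat)%:R * p.2) ->
  \sum_(k < n) A i k * f k = \sum_(p <- s) p.2 * f p.1.
Proof.
by move=> sn AE; rewrite -(sum_deltas f s sn); apply: eq_bigr => k _; rewrite AE.
Qed.

(** Zero-based tests without differences in [int], so that case splits on them can be closed by
    [lia]. *)
Lemma BmxE (R : realType) (a b : R) (n : nat) (i k : 'I_n) : (1 < n)%N ->
  Bmx n a b i k =
    if (i <= k.+2)%N && (k <= i.+1)%N then 1
    else if (i == 0%N :> nat) && (k == n.-2 :> nat)
            || (i == 1%N :> nat) && (k == n.-1 :> nat) then a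
    else if (i == 0%N :> nat) && (k == n.-1 :> nat) then b else 0.
Proof.
move=> n1; rewrite mxE !xpair_eqE.
have -> : (-2 <= k%:Z - i%:Z) && (k%:Z - i%:Z <= 1)
        = (i <= k.+2)%N && (k <= i.+1)%N by lia.
have -> : (k.+1 == n)%N = (k == n.-1 :> nat) by have := ltn_ord k; lia.
suff -> : (k.+1 == n - 1)%N = (k == n.-2 :> nat) by [].
by have := ltn_ord k; lia.
Qed.

Ltac Bmx_row_tac s :=
  rewrite (sparse_row s) /=;
  [ by rewrite !big_cons big_nil /= !mul1r ?addr0 ?addrA
  | by lia
  | let k := fresh "k" in
    move=> k; rewrite BmxE; [rewrite !big_cons big_nil /= | lia];
    have := ltn_ord k; move: (nat_of_ord k) => {}k;
    do ![case: (@eqP nat) => ?; try lia | case: ifP => ?; try lia];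
       rewrite /= !(mul0r, mul1r, add0r, addr0) // ].

Lemma Bmx_row0 (R : realType) (a b : R) (n : nat) (f : nat -> R) (i : 'I_n) :
  (5 <= n)%N -> i = 0%N :> nat ->
  \sum_(k < n) Bmx n a b i k * f k = f 0%N + f 1%N + a * f n.-2 + b * f n.-1.
Proof.
by move=> n5 i0; Bmx_row_tac [:: (0%N, 1); (1%N, 1); (n.-2, a); (n.-1, b)].
Qed.

Lemma Bmx_row1 (R : realType) (a b : R) (n : nat) (f : nat -> R) (i : 'I_n) :
  (5 <= n)%N -> i = 1%N :> nat ->
  \sum_(k < n) Bmx n a b i k * f k = f 0%N + f 1%N + f 2%N + a * f n.-1.
Proof.
by move=> n5 i1; Bmx_row_tac [:: (0%N, 1); (1%N, 1); (2%N, 1); (n.-1, a)].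
Qed.

Lemma Bmx_row_mid (R : realType) (a b : R) (n r : nat) (f : nat -> R) (i : 'I_n) :
  (r.+3 < n)%N -> i = r.+2 :> nat ->
  \sum_(k < n) Bmx n a b i k * f k = f r + f r.+1 + f r.+2 + f r.+3.
Proof.
by move=> rn ir; Bmx_row_tac [:: (r, 1); (r.+1, 1); (r.+2, 1); (r.+3, 1) : nat * R].
Qed.

Lemma Bmx_row_last (R : realType) (a b : R) (n : nat) (f : nat -> R) (i : 'I_n.+3) :
  (1 < n)%N -> i = n.+2 :> nat ->
  \sum_(k < n.+3) Bmx n.+3 a b i k * f k = f n + f n.+1 + f n.+2.
Proof.
by move=> n1 ii; Bmx_row_tac [:: (n, 1); (n.+1, 1); (n.+2, 1) : nat * R].
Qed.

Definition Pmx (R : pzRingType) (n : nat) : 'M[R]_n :=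
  \matrix_(i < n, j < n) if (j < 3)%N then kerseq j i else (i == j)%:R.

(** The matrix is lower triangular: above the diagonal, a column [j < 3] is read only at rows
    [i < j], where [kerseq j] is still a basis vector. *)
Lemma det_Pmx (R : comPzRingType) (n : nat) : \det (Pmx R n) = 1.
Proof.
rewrite det_trig; last first.
  apply/is_trig_mxP => i j ij; rewrite mxE -val_eqE /= (ltn_eqF ij).
  by case: ifP => // j3; rewrite kerseq_small ?(ltn_trans ij) // (ltn_eqF ij).
by apply: big1 => i _; rewrite mxE; case: ifP => [i3|_]; rewrite ?kerseq_small ?eqxx.
Qed.

(* The sum of terms m, m + 1, m + 2 of [kerseq j] is minus its term m + 3. *)
Definition corner {R : pzRingType} (a b : R) (m i j : nat) : R :=
  [:: kerseq j 0 + kerseq j 1 + a * kerseq j m.+1 + b * kerseq j m.+2;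
      kerseq j 0 + kerseq j 1 + kerseq j 2 + a * kerseq j m.+2;
      - kerseq j m.+3]`_i.

(** Lifting the identity keeps the other rows in order and makes the parity readable from the two
    indices. The size [3 + m] fits the block decomposition. *)
Definition last_to_third (m : nat) : 'S_(3 + m) :=
  lift_perm (inord 2) ord_max 1%g.

Lemma last_to_thirdE (m : nat) (i : 'I_(3 + m)) :
  last_to_third m i = (if i < 2 then i : nat
                       else if i == 2 :> nat then m.+2 else i.-1)%N :> nat.
Proof.
have i2 : (inord 2 : 'I_m.+3) = 2%N :> nat by rewrite inordK.
case: (unliftP (inord 2 : 'I_m.+3) i) => [k|] ->; last first.
  by rewrite lift_perm_id i2.
rewrite lift_perm_lift perm1 /= /bump i2.
have := ltn_ord k; move: (nat_of_ord k) => {}k.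
by case: (leqP 2 k) => ?; case: (leqP m.+2 k) => ? /= km; do 2?case: ifP; lia.
Qed.

Lemma det_Bmx (R : realType) (a b : R) (m : nat) : (1 < m)%N ->
  \det (Bmx m.+3 a b) = (-1) ^+ m * \det (\matrix_(i < 3, j < 3) corner a b m i j).
Proof.
move=> m1; pose s := last_to_third m.
pose Q := row_perm s (Bmx (3 + m) a b) *m Pmx R (3 + m).
have detQ : \det Q = (-1) ^+ m * \det (Bmx m.+3 a b).
  (* The permutation has the parity of 2 + (m + 2), hence the sign (-1)^m. *)
  rewrite det_mulmx det_Pmx mulr1 row_permE det_mulmx det_perm odd_lift_perm odd_perm1.
  have -> : odd (inord 2 : 'I_m.+3) = false by rewrite inordK.
  by rewrite /= negbK addbF signr_odd.
have QE i j : Q i j = if (j < 3)%N then \sum_k Bmx m.+3 a b (s i) k * kerseq j k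
                      else Bmx m.+3 a b (s i) j.
  rewrite mxE; under eq_bigr do rewrite [row_perm _ _ _ _]mxE [Pmx _ _ _ _]mxE.
  case: ifP => // _; rewrite (bigD1 j) //= eqxx mulr1 big1 ?addr0 // => k /negbTE ->.
  by rewrite mulr0.
have sE r : s (rshift 3 r) = r.+2 :> nat by rewrite last_to_thirdE.
have n5 : (5 <= m.+3)%N by [].
have ulE : ulsubmx Q = \matrix_(i < 3, j < 3) corner a b m i j.
  apply/matrixP=> i j; rewrite [RHS]mxE [LHS]mxE [LHS]mxE QE /= ltn_ord.
  have := last_to_thirdE m (lshift m i); rewrite -/s.
  case: i => [[|[|[|]]] i3] //= si.
  - by rewrite Bmx_row0.
  - by rewrite Bmx_row1.
  - rewrite Bmx_row_last //; apply/eqP; rewrite -addr_eq0.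
    by rewrite kerseq_sum4.
have dlE : dlsubmx Q = 0.
  apply/matrixP=> r j; rewrite [RHS]mxE [LHS]mxE [LHS]mxE QE /= ltn_ord.
  by rewrite (Bmx_row_mid _ _ _ _ r) ?sE ?kerseq_sum4 // !ltnS.
(* This entry is the one of [Bmx] at row r + 2 and column c + 3: the offset of one puts the
   superdiagonal of ones on the diagonal of the block, with zeros above it. *)
have drE r c : drsubmx Q r c = if (r <= c.+3)%N && (c <= r)%N then 1 else 0.
  by rewrite [LHS]mxE [LHS]mxE QE /= BmxE // sE.
have det_dr : \det (drsubmx Q) = 1.
  rewrite det_trig; last by apply/is_trig_mxP=> r c rc; rewrite drE (leqNgt c) rc andbF.
  by rewrite big1 // => r _; rewrite drE leqnn -addn3 leq_addr.
by rewrite -[LHS](signrMK m) -detQ -(submxK Q) dlE det_ublock det_dr mulr1 ulE.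
Qed.

Lemma det_mx33 (R : comPzRingType) (F : nat -> nat -> R) :
  \det (\matrix_(i < 3, j < 3) F i j) =
    F 0 0 * (F 1 1 * F 2 2 - F 1 2 * F 2 1)
    - F 0 1 * (F 1 0 * F 2 2 - F 1 2 * F 2 0)
    + F 0 2 * (F 1 0 * F 2 1 - F 1 1 * F 2 0).
Proof.
do 2!rewrite !(expand_det_row _ ord0) !(big_ord_recl, big_ord0) /cofactor.
by rewrite !det_mx11 !mxE /= /bump /=; ring.
Qed.

Theorem theorem3 (R : realType) (a b : R) (n : nat) (hn : (5 <= n)%N) :
  [/\ n = 0 %[mod 4] -> \det (Bmx n a b) = (a - 1) ^+ 2,
      n = 1 %[mod 4] -> \det (Bmx n a b) = a ^+ 2 + b + 1,
      n = 2 %[mod 4] -> \det (Bmx n a b) = a ^+ 2 + 2 * a - b &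
      n = 3 %[mod 4] -> \det (Bmx n a b) = a ^+ 2].
Proof.
case: n hn => [|[|[|m]]] // hn.
(* [D] is only a formula, so it may be evaluated at residues 0 and 1 although [det_Bmx] requires
   [1 < m]. The sign has period 2 in [m] and the corner entries have period 4. *)
pose D k := (-1) ^+ k * \det (\matrix_(i < 3, j < 3) corner a b k i j).
have detE : \det (Bmx m.+3 a b) = D (m %% 4)%N.
  rewrite /D det_Bmx // -signr_odd -[in RHS]signr_odd (_ : odd m = odd (m %% 4)); last lia.
  congr (_ * \det _); apply/matrixP=> i j; rewrite !mxE /corner.
  by rewrite (kerseq_modD j 1 m) (kerseq_modD j 2 m) (kerseq_modD j 3 m).
(* Since n = m + 3, the residue of m is that of r - 3, that is, of r + 1. *)
have {}detE r : m.+3 = r %[mod 4] -> \det (Bmx m.+3 a b) = D ((r + 1) %% 4)%N.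
  by move=> mr; rewrite detE (_ : (m %% 4 = (r + 1) %% 4)%N); last lia.
split=> /detE ->; rewrite /D det_mx33 /corner /kerseq /=; ring.
Qed.
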